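(* Let $X$ be a topological space, let the coefficients $G$ be a ring, and let $q\ge 0$. Let $z\in\check H^q(X)$ and $\gamma\in\check H_q(X)$. Choose a $q$-cochain $\xi$ that represents $z$, an open covering $\mathcal U$ of $X$ such that $\delta\xi$ is zero over each member of $\mathcal U$, and a $\mathcal U$-small representative $c$ of $\gamma$. Then the element $\xi(c)\in G$ is independent of the choices of $c$, $\mathcal U$ and $\xi$. (Hence the integral $\int_\gamma z:=\xi(c)$ is well defined.)
   Context: Let $\mathcal U$ be an open covering of $X$. Homology. A formal $q$-simplex is an ordered tuple $\sigma=(x_0\ \ldots\ x_q)$ of points of $X$ (repetitions allowed); it is $\mathcal U$-small if all $x_i$ lie in a common element of $\mathcal U$. A formal $q$-chain is a finite linear combination $\sum k_i\sigma_i$ of formal $q$-simplices with $k_i\in G$; it is $\mathcal U$-small if all the $\sigma_i$ are. The $\mathcal U$-small $q$-chains form $S^{\mathcal U}_q(X)$, with boundary $\partial(x_0\ \ldots\ x_q)=\sum_{j=0}^q(-1)^j(x_0\ \ldots\ \widehat{x_j}\ \ldots\ x_q)$. $H_q^{\mathcal U}(X)$ is the $q$-th homology of this complex. If $\mathcal V$ refines $\mathcal U$, inclusion of chains induces $H_q^{\mathcal V}(X)\to H_q^{\mathcal U}(X)$, and $\check H_q(X)=\varprojlim_{\mathcal U}H_q^{\mathcal U}(X)$ (Čech homology). An element $\gamma\in\check H_q(X)$ is a coherent family $(\gamma^{\mathcal U})_{\mathcal U}$; a $\mathcal U$-small representative of $\gamma$ is a $\mathcal U$-small cycle representing $\gamma^{\mathcal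 U}$. Cohomology. $C^q(X)$ is the set of all functions $\xi\colon X^{q+1}\to G$ ($q$-cochains), with $\delta\xi(x_0,\ldots,x_{q+1})=\sum_{j=0}^{q+1}(-1)^j\xi(x_0,\ldots,\widehat{x_j},\ldots,x_{q+1})$. A cochain is zero over each member of $\mathcal U$ ($\mathcal U$-locally zero) if it vanishes on all tuples contained in a single member of $\mathcal U$; it is locally zero if this holds for some open covering $\mathcal U$. $\check H^q(X)$ is the Alexander--Spanier cohomology, i.e. the cohomology of $C^*(X)$ modulo locally zero cochains. A cochain $\xi$ represents $z\in \check H^q(X)$ if $\delta\xi$ is locally zero and $z$ is the resulting class. Evaluation. For $c=\sum k_i\sigma_i$, $\xi(c):=\sum k_i\,\xi(\sigma_i)$, where $\xi((x_0\ \ldots\ x_q)):=\xi(x_0,\ldots,x_q)$. *)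

(* Defs.v *)
From HB Require Import structures.
From mathcomp Require Import all_boot all_order all_algebra.
From mathcomp Require Import finmap.
From mathcomp Require Import monalg.
From mathcomp Require Import boolp classical_sets functions topology.

Set Implicit Arguments.
Unset Strict Implicit.
Unset Printing Implicit Defensive.

Import GRing.Theory.
Local Open Scope classical_set_scope.
Local Open Scope ring_scope.
Local Open Scope quotient_scope.

(* The homology ker g / im f of A -f-> B -g-> C. The condition g \o f = 0 is *)
(* not needed to form it: the quotient is by the cycles lying in the image   *)
(* of f.                                                                     *)
Section Homology.
Variables (A B C : zmodType) (f : {additive A -> B}) (g : {additive B -> C}).

Definition is_cycle : {pred B} := [pred b | g b == 0].

Fact is_cycle_zmod_closed : zmod_closed is_cycle.
Proof.
split=> [|x y]; rewrite !inE ?raddf0 // => /eqP gx /eqP gy.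
by rewrite raddfB gx gy subrr.
Qed.
HB.instance Definition _ := GRing.isZmodClosed.Build B is_cycle
  is_cycle_zmod_closed.

Record cycles := Cycle { cycle_val :> B; cycleP : cycle_val \in is_cycle }.
HB.instance Definition _ := [isSub for cycle_val].
HB.instance Definition _ := [Choice of cycles by <:].
HB.instance Definition _ := [SubChoice_isSubZmodule of cycles by <:].

Definition is_boundary : {pred cycles} :=
  fun b => `[< exists a : A, f a = cycle_val b >].

Fact is_boundary_zmod_closed : zmod_closed is_boundary.
Proof.
split=> [|x y].
  by apply/asboolP; exists 0; rewrite raddf0.
move=> /asboolP[a fa] /asboolP[b fb]; apply/asboolP; exists (a - b).
by rewrite raddfB fa fb.
Qed.
HB.instance Definition _ := GRing.isZmodClosed.Build cycles is_boundary
  is_boundary_zmod_closed.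

Definition homology : zmodType := {ideal_quot is_boundary}.

Definition homology_class (c : cycles) : homology := \pi c.

Lemma homology_classP (c d : cycles) :
  homology_class c = homology_class d <->
  exists a : A, f a = cycle_val c - cycle_val d.
Proof.
split=> [/eqP|h].
  by rewrite /homology_class -Quotient.idealrBE => /asboolP.
by apply/eqP; rewrite /homology_class -Quotient.idealrBE; apply/asboolP.
Qed.

End Homology.

Section HomologyMap.
Variables (A B C : zmodType) (f : {additive A -> B}) (g : {additive B -> C}).
Variables (A' B' C' : zmodType).
Variables (f' : {additive A' -> B'}) (g' : {additive B' -> C'}).
Variables (v : {additive B -> B'}) (w : {additive C -> C'}).
Hypothesis vw : forall b, w (g b) = g' (v b).

Fact map_cycles_subproof (c : cycles g) : v (cycle_val c) \in is_cycle g'.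
Proof. by rewrite inE -vw; case: c => b /= /eqP->; rewrite raddf0. Qed.

Definition map_cycles (c : cycles g) : cycles g' := Cycle (map_cycles_subproof c).

Definition homology_map (h : homology f g) : homology f' g' :=
  homology_class f' (map_cycles (repr h)).

Lemma homology_mapE (u : {additive A -> A'}) (c : cycles g) :
  (forall a, v (f a) = f' (u a)) ->
  homology_map (homology_class f c) = homology_class f' (map_cycles c).
Proof.
move=> uv; apply/homology_classP => /=.
have : homology_class f (repr (homology_class f c)) = homology_class f c.
  exact: reprK.
by move/homology_classP => [a fa]; exists (u a); rewrite -uv fa raddfB.
Qed.

End HomologyMap.
Arguments homology_map {A B C f g A' B' C' f' g' v w} vw h.

Section OpenCovers.
Variable X : topologicalType.

Record open_cover := OpenCover {
  members : set (set X);
  members_open : forall A, members A -> open A;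
  members_cover : cover members id = setT
}.

Definition refines (V U : open_cover) : Prop :=
  forall A, members V A -> exists2 B, members U B & A `<=` B.

Fact common_refinement_open (U V : open_cover) (A : set X) :
  [set A `&` B | A in members U & B in members V] A -> open A.
Proof. by case=> B UB [C VC <-]; apply: openI; apply: members_open; eauto. Qed.

Fact common_refinement_cover (U V : open_cover) :
  cover [set A `&` B | A in members U & B in members V] id = setT.
Proof.
apply/seteqP; split=> // x _.
have : cover (members U) id x by rewrite members_cover.
have : cover (members V) id x by rewrite members_cover.
case=> B VB Bx [A UA Ax]; exists (A `&` B) => //.
by exists A => //; exists B.
Qed.

Definition common_refinement (U V : open_cover) : open_cover :=
  OpenCover (@common_refinement_open U V) (common_refinement_cover U V).

Fact trivial_cover_open (A : set X) : [set setT] A -> open A.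
Proof. by move=> ->; exact: openT. Qed.

Fact trivial_cover_cover : cover [set (setT : set X)] id = setT.
Proof. by apply/seteqP; split=> // x _; exists setT. Qed.

Definition trivial_cover := OpenCover trivial_cover_open trivial_cover_cover.

End OpenCovers.

Section Simplices.
Variable X : choiceType.

Definition simplex (q : nat) := q.+1.-tuple X.
HB.instance Definition _ q := Choice.on (simplex q).

Definition face (q : nat) (j : 'I_q.+2) (s : simplex q.+1) : simplex q :=
  [tuple tnth s (lift j i) | i < q.+1].

Definition simplex_in (q : nat) (A : set X) (s : simplex q) : Prop :=
  forall i, A (tnth s i).

Lemma face_in q (A : set X) j (s : simplex q.+1) :
  simplex_in A s -> simplex_in A (face j s).
Proof. by move=> sA i; rewrite tnth_mktuple. Qed.

End Simplices.

Section Chains.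
Variables (X : topologicalType) (G : pzRingType).

Definition chain (q : nat) := {malg G[simplex X q]}.
HB.instance Definition _ q := GRing.Zmodule.on (chain q).

Definition bd (q : nat) (c : chain q.+1) : chain q :=
  \sum_(s <- msupp c) \sum_(j < q.+2) << (-1) ^+ j * c@_s *g face j s >>.

Lemma bdEw q (c : chain q.+1) (d : {fset simplex X q.+1}) :
  (msupp c `<=` d)%fset ->
  bd c = \sum_(s <- d) \sum_(j < q.+2) << (-1) ^+ j * c@_s *g face j s >>.
Proof.
move=> cd; rewrite /bd (big_fset_incl _ cd) // => s _ sc.
by apply: big1 => j _; rewrite mcoeff_outdom // mulr0 monalgU0.
Qed.

Fact bd_is_additive q : zmod_morphism (@bd q).
Proof.
move=> c d; pose D := (msupp c `|` msupp d)%fset.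
rewrite (@bdEw _ (c - d) D) ?msuppB_le // (@bdEw _ c D) ?fsubsetUl //.
rewrite (@bdEw _ d D) ?fsubsetUr // -sumrB; apply: eq_bigr => s _.
by rewrite -sumrB; apply: eq_bigr => j _; rewrite mcoeffB mulrBr monalgUB.
Qed.
HB.instance Definition _ q :=
  GRing.isZmodMorphism.Build (chain q.+1) (chain q) (@bd q) (@bd_is_additive q).

Definition small_simplex (U : open_cover X) q (s : simplex X q) : Prop :=
  exists2 A, members U A & simplex_in A s.

Definition is_small (U : open_cover X) q : {pred chain q} :=
  fun c => `[< forall s, s \in msupp c -> small_simplex U s >].

Fact is_small_zmod_closed U q : zmod_closed (@is_small U q).
Proof.
split=> [|c d]; first by apply/asboolP => s; rewrite msupp0 inE.
move=> /asboolP cU /asboolP dU; apply/asboolP => s.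
by move=> /(fsubsetP (msuppB_le _ _)); rewrite inE => /orP[/cU|/dU].
Qed.
HB.instance Definition _ U q := GRing.isZmodClosed.Build (chain q)
  (@is_small U q) (@is_small_zmod_closed U q).

Record small_chain (U : open_cover X) (q : nat) := SmallChain {
  small_chain_val :> chain q;
  small_chainP : small_chain_val \in @is_small U q
}.
HB.instance Definition _ U q := [isSub for @small_chain_val U q].
HB.instance Definition _ U q := [Choice of small_chain U q by <:].
HB.instance Definition _ U q :=
  [SubChoice_isSubZmodule of small_chain U q by <:].

Section Boundary.
Variables (U : open_cover X) (q : nat).

Fact small_bd_subproof (c : small_chain U q.+1) : bd c \in @is_small U q.
Proof.
case: c => c /= /asboolP cU; rewrite /bd big_seq; apply: rpred_sum => s sc.
apply: rpred_sum => j _; apply/asboolP => t /(fsubsetP msuppU_le).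
rewrite inE => /eqP->; have [A UA sA] := cU _ sc; exists A => //.
exact: face_in.
Qed.

Definition small_bd (c : small_chain U q.+1) : small_chain U q :=
  SmallChain (small_bd_subproof c).

Fact small_bd_is_additive : zmod_morphism small_bd.
Proof.
move=> c d; apply: val_inj; rewrite [RHS]raddfB /= -raddfB.
by congr bd; exact: (raddfB val).
Qed.
HB.instance Definition _ := GRing.isZmodMorphism.Build
  (small_chain U q.+1) (small_chain U q) small_bd small_bd_is_additive.

End Boundary.

(* The boundary out of degree q; there are no chains in negative degrees, so *)
(* it vanishes for q = 0.                                                    *)
Definition bd_from (U : open_cover X) (q : nat) :
    {additive small_chain U q -> small_chain U q.-1} :=
  match q with 0 => \0 | p.+1 => @small_bd U p end.

Definition small_homology (U : open_cover X) (q : nat) : zmodType :=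
  homology (@small_bd U q) (bd_from U q).

Section Refinement.
Variables (V U : open_cover X) (VU : refines V U).

Fact small_incl_subproof q (c : small_chain V q) :
  small_chain_val c \in @is_small U q.
Proof.
case: c => c /= /asboolP cV; apply/asboolP => s /cV[A VA sA].
by have [B UB AB] := VU VA; exists B => // i; exact: AB.
Qed.

Definition small_incl q (c : small_chain V q) : small_chain U q :=
  SmallChain (small_incl_subproof c).

Fact small_incl_is_additive q : zmod_morphism (@small_incl q).
Proof.
by move=> c d; apply: val_inj; rewrite [RHS](raddfB val) [LHS](raddfB val).
Qed.
HB.instance Definition _ q := GRing.isZmodMorphism.Build
  (small_chain V q) (small_chain U q) (@small_incl q)
  (@small_incl_is_additive q).

Fact small_incl_bd q (c : small_chain V q.+1) :
  small_incl (small_bd c) = small_bd (small_incl c).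
Proof. exact: val_inj. Qed.

Fact small_incl_bd_from q (c : small_chain V q) :
  small_incl (bd_from V q c) = bd_from U q (small_incl c).
Proof. by case: q c => [|q] c; apply: val_inj. Qed.

Definition refinement_map (q : nat) :
    small_homology V q -> small_homology U q :=
  homology_map (v := @small_incl q) (w := @small_incl q.-1)
    (@small_incl_bd_from q).

Lemma refinement_mapE q (c : cycles (bd_from V q)) :
  refinement_map (homology_class (@small_bd V q) c) =
  homology_class (@small_bd U q) (map_cycles (@small_incl_bd_from q) c).
Proof. exact: homology_mapE (@small_incl_bd q). Qed.

End Refinement.

(* The inverse limit is taken over all open coverings, ordered by            *)
(* refinement; its elements are the coherent families.                       *)
Record cech_homology (q : nat) := CechHomology {
  component :> forall U : open_cover X, small_homology U q;
  component_coherent : forall (V U : open_cover X) (VU : refines V U),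
    refinement_map VU (component V) = component U
}.

Definition small_cycle (U : open_cover X) (q : nat) := cycles (bd_from U q).

Definition cycle_chain (U : open_cover X) (q : nat) (c : small_cycle U q) :
    chain q := small_chain_val (cycle_val c).

Definition small_representative (q : nat) (gamma : cech_homology q)
    (U : open_cover X) (c : small_cycle U q) : Prop :=
  homology_class (@small_bd U q) c = gamma U.

End Chains.

Section Cochains.
Variables (X : topologicalType) (G : pzRingType).

Definition cochain (q : nat) := simplex X q -> G.
HB.instance Definition _ q := GRing.Zmodule.on (cochain q).

Definition cobd (q : nat) (xi : cochain q) : cochain q.+1 :=
  fun s => \sum_(j < q.+2) (-1) ^+ j * xi (face j s).

Fact cobd_is_additive q : zmod_morphism (@cobd q).
Proof.
move=> xi eta; apply/funext => s; rewrite /cobd !fctE -sumrB.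
by apply: eq_bigr => j _; rewrite mulrBr.
Qed.
HB.instance Definition _ q := GRing.isZmodMorphism.Build
  (cochain q) (cochain q.+1) (@cobd q) (@cobd_is_additive q).

Definition zero_over (U : open_cover X) (q : nat) (xi : cochain q) : Prop :=
  forall A, members U A -> forall s, simplex_in A s -> xi s = 0.

Definition locally_zero (q : nat) : {pred cochain q} :=
  fun xi => `[< exists U, zero_over U xi >].

Fact locally_zero_zmod_closed q : zmod_closed (@locally_zero q).
Proof.
split=> [|xi eta]; first by apply/asboolP; exists (trivial_cover X).
move=> /asboolP[U xiU] /asboolP[V etaV]; apply/asboolP.
exists (common_refinement U V) => _ [A UA [B VB <-]] s sAB.
rewrite !fctE (xiU A UA) ?(etaV B VB) ?subrr // => i; by case: (sAB i).
Qed.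
HB.instance Definition _ q := GRing.isZmodClosed.Build (cochain q)
  (@locally_zero q) (@locally_zero_zmod_closed q).

Lemma cobd_locally_zero q (xi : cochain q) :
  xi \in @locally_zero q -> cobd xi \in @locally_zero q.+1.
Proof.
move=> /asboolP[U xiU]; apply/asboolP; exists U => A UA s sA.
apply: big1 => j _; rewrite (xiU A) ?mulr0 //; exact: face_in.
Qed.

(* The complex of Alexander-Spanier cochains: all cochains modulo the        *)
(* locally zero ones.                                                        *)
Definition as_cochain (q : nat) : zmodType := {ideal_quot @locally_zero q}.

Definition germ (q : nat) (xi : cochain q) : as_cochain q := \pi xi.

Lemma germ_eq q (xi eta : cochain q) :
  germ xi = germ eta <-> xi - eta \in @locally_zero q.
Proof.
rewrite /germ; split=> [/eqP|h].
  by rewrite -Quotient.idealrBE.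
by apply/eqP; rewrite -Quotient.idealrBE.
Qed.

Fact germ_is_additive q : zmod_morphism (@germ q).
Proof. by move=> xi eta; rewrite /germ raddfB. Qed.
HB.instance Definition _ q := GRing.isZmodMorphism.Build
  (cochain q) (as_cochain q) (@germ q) (@germ_is_additive q).

Definition as_cobd (q : nat) (x : as_cochain q) : as_cochain q.+1 :=
  germ (cobd (repr x)).

Lemma as_cobdE q (xi : cochain q) : as_cobd (germ xi) = germ (cobd xi).
Proof.
apply/germ_eq; rewrite -raddfB; apply: cobd_locally_zero.
by apply/germ_eq; exact: reprK.
Qed.

Fact as_cobd_is_additive q : zmod_morphism (@as_cobd q).
Proof.
move=> x y.
have [xi <-] : exists xi, germ xi = x by exists (repr x); exact: reprK.
have [eta <-] : exists eta, germ eta = y by exists (repr y); exact: reprK.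
by rewrite -[germ xi - _](raddfB (@germ q)) /= !as_cobdE !raddfB.
Qed.
HB.instance Definition _ q := GRing.isZmodMorphism.Build
  (as_cochain q) (as_cochain q.+1) (@as_cobd q) (@as_cobd_is_additive q).

(* The coboundary into degree q, zero for q = 0. *)
Definition as_cobd_to (q : nat) :
    {additive as_cochain q.-1 -> as_cochain q} :=
  match q with 0 => \0 | p.+1 => @as_cobd p end.

Definition alexander_spanier (q : nat) : zmodType :=
  homology (as_cobd_to q) (@as_cobd q).

Fact germ_cycle_subproof q (xi : cochain q) :
  cobd xi \in @locally_zero q.+1 -> germ xi \in is_cycle (@as_cobd q).
Proof.
move=> xi0; apply/eqP; apply: (etrans (as_cobdE xi)).
by rewrite -(raddf0 (@germ q.+1)); apply/germ_eq; rewrite subr0.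
Qed.

Definition cocycle_class (q : nat) (xi : cochain q)
    (xi0 : cobd xi \in @locally_zero q.+1) : alexander_spanier q :=
  homology_class (as_cobd_to q) (Cycle (germ_cycle_subproof xi0)).

Definition represents (q : nat) (xi : cochain q) (z : alexander_spanier q) :
    Prop :=
  exists xi0 : cobd xi \in @locally_zero q.+1, cocycle_class xi0 = z.

Definition evaluate (q : nat) (xi : cochain q) (c : chain X G q) : G :=
  \sum_(s <- msupp c) c@_s * xi s.

End Cochains.

(* Main.v *)
From HB Require Import structures.
Require Import Defs.
From mathcomp Require Import all_boot all_algebra.
From mathcomp Require Import finmap monalg boolp classical_sets functions.
From mathcomp Require Import topology.

(** Evaluation is a pairing between chains and cochains that is additive on
both sides and turns the boundary into the coboundary (Stokes' formula
[evaluate_bd]; the signs are central, so [G] may be non-commutative). A cochain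
that is zero over the members of [U] pairs to zero with every [U]-small chain.
Consequently, when [cobd xi] is zero over [U], the value [xi(c)] depends only
on the [U]-homology class of the [U]-small cycle [c]
([evaluate_homologous]).

Two representatives [xi] and [xi'] of the same class differ by a coboundary
plus a cochain that is zero over some covering [V] ([represents_eq_evaluate]),
so they agree on all cycles that are [V]-small: on such a cycle the coboundary
pairs to zero by Stokes' formula again. To compare [xi(c)] with [xi'(c')], take
a representative [d] of [gamma] that is small for a common refinement of [U],
[U'] and [V]. By coherence of [gamma], [d] is [U]-homologous to [c] and
[U']-homologous to [c'], whence [xi(c) = xi(d) = xi'(d) = xi'(c')]. *)

Set Implicit Arguments.
Unset Strict Implicit.
Unset Printing Implicit Defensive.

Import GRing.Theory.
Local Open Scope ring_scope.

Section Refinement.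
Variable X : topologicalType.

Lemma refines_trans (U V W : open_cover X) :
  refines W V -> refines V U -> refines W U.
Proof.
move=> WV VU A /WV[B /VU[C UC BC] AB]; exists C => //.
exact: (subset_trans AB).
Qed.

Lemma common_refinementl (U V : open_cover X) :
  refines (common_refinement U V) U.
Proof. by move=> _ [A UA [B VB <-]]; exists A => // x []. Qed.

Lemma common_refinementr (U V : open_cover X) :
  refines (common_refinement U V) V.
Proof. by move=> _ [A UA [B VB <-]]; exists B => // x []. Qed.

End Refinement.

Section Evaluation.
Variables (X : topologicalType) (G : pzRingType).

Lemma evaluateEw q (xi : cochain X G q) (c : chain X G q)
    (D : {fset simplex X q}) :
  (msupp c `<=` D)%fset -> evaluate xi c = \sum_(s <- D) c@_s * xi s.
Proof.
move=> cD; rewrite /evaluate (big_fset_incl _ cD) // => s _ sc.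
by rewrite mcoeff_outdom // mul0r.
Qed.

Fact evaluate_is_additive q (xi : cochain X G q) : zmod_morphism (evaluate xi).
Proof.
move=> c d; pose D := (msupp c `|` msupp d)%fset.
rewrite (@evaluateEw _ _ (c - d) D) ?msuppB_le //.
rewrite (@evaluateEw _ _ c D) ?fsubsetUl //.
rewrite (@evaluateEw _ _ d D) ?fsubsetUr // -sumrB.
by apply: eq_bigr => s _; rewrite mcoeffB mulrBl.
Qed.
HB.instance Definition _ q (xi : cochain X G q) :=
  GRing.isZmodMorphism.Build (chain X G q) G (evaluate xi)
    (@evaluate_is_additive q xi).

Lemma evaluateBl q (xi eta : cochain X G q) (c : chain X G q) :
  evaluate (xi - eta) c = evaluate xi c - evaluate eta c.
Proof.
by rewrite /evaluate -sumrB; apply: eq_bigr => s _; rewrite fctE mulrBr.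
Qed.

Lemma evaluate_simplex q (xi : cochain X G q) (k : G) (s : simplex X q) :
  evaluate xi << k *g s >> = k * xi s.
Proof.
by rewrite (evaluateEw _ msuppU_le) big_seq_fset1 mcoeffUU.
Qed.

(** Stokes' formula. The boundary puts its sign to the left of a coefficient,
the coboundary puts its sign to the right of it; signs are central. *)
Lemma evaluate_bd q (xi : cochain X G q) (c : chain X G q.+1) :
  evaluate xi (bd c) = evaluate (cobd xi) c.
Proof.
rewrite /bd raddf_sum; apply: eq_bigr => s _.
rewrite raddf_sum /cobd mulr_sumr; apply: eq_bigr => j _.
by rewrite [LHS]evaluate_simplex mulrA; congr (_ * _); exact/esym/commr_sign.
Qed.

Lemma evaluate_zero_over q (U : open_cover X) (xi : cochain X G q)
    (c : small_chain G U q) :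
  zero_over U xi -> evaluate xi (small_chain_val c) = 0.
Proof.
case: c => c /= /asboolP cU xiU; rewrite /evaluate big_seq.
by apply: big1 => s /cU[A UA sA]; rewrite (xiU A UA s sA) mulr0.
Qed.

Lemma evaluate_homologous q (U : open_cover X) (xi : cochain X G q)
    (c d : small_cycle G U q) :
  zero_over U (cobd xi) ->
  homology_class (@small_bd X G U q) c = homology_class (@small_bd X G U q) d ->
  evaluate xi (cycle_chain c) = evaluate xi (cycle_chain d).
Proof.
move=> xiU /homology_classP[a ca]; apply/eqP; rewrite -subr_eq0 -raddfB.
have -> : cycle_chain c - cycle_chain d = bd (small_chain_val a).
  exact: esym (etrans (congr1 val ca) (raddfB val _ _)).
by apply/eqP; rewrite [LHS]evaluate_bd evaluate_zero_over.
Qed.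

(** Modulo a coboundary, which pairs to zero with every cycle, the two
cochains agree on the simplices inside the members of [V]. *)
Lemma represents_eq_evaluate q (xi xi' : cochain X G q)
    (z : alexander_spanier X G q) :
  represents xi z -> represents xi' z ->
  exists V : open_cover X, forall W, refines W V ->
    forall c : small_cycle G W q,
      evaluate xi (cycle_chain c) = evaluate xi' (cycle_chain c).
Proof.
move=> [h <-] [h' /esym /homology_classP /= [a ha]].
(* [zeta] is the difference of the two cochains, corrected by a coboundary so
   that it becomes locally zero. *)
suff [zeta [/asboolP[V zetaV] zetaE]] : exists zeta : cochain X G q,
    zeta \in @locally_zero X G q /\
    forall W (c : small_cycle G W q),
      evaluate zeta (cycle_chain c) = evaluate (xi - xi') (cycle_chain c).
  exists V => W WV c; apply/eqP; rewrite -subr_eq0 -evaluateBl -zetaE.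
  apply/eqP/evaluate_zero_over => A /WV[B VB AB] s sA.
  by apply: (zetaV B VB) => i; apply: AB.
case: q xi xi' z h h' a ha => [|p] xi xi' z h h' a /=.
  (* There are no coboundaries in degree 0: the difference itself is locally
     zero. *)
  move=> /esym/eqP; rewrite subr_eq0 => /eqP /germ_eq xiB.
  by exists (xi - xi').
have [eta <-] : exists eta : cochain X G p, germ eta = a.
  by exists (repr a); exact: reprK.
rewrite [LHS]as_cobdE -(raddfB (@germ X G p.+1)) => /esym/germ_eq etaE.
exists (xi - xi' - cobd eta); split=> // W c; rewrite evaluateBl.
suff -> : evaluate (cobd eta) (cycle_chain c) = 0 by rewrite subr0.
rewrite -evaluate_bd /cycle_chain; case: c => c /= /eqP c0.
by rewrite (congr1 val c0 : bd (small_chain_val c) = 0); exact: raddf0.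
Qed.

Lemma exists_small_representative q (gamma : cech_homology X G q)
    (U : open_cover X) :
  exists c : small_cycle G U q, small_representative gamma c.
Proof. by exists (repr (gamma U)); exact: reprK. Qed.

Lemma exists_represents q (z : alexander_spanier X G q) :
  exists xi : cochain X G q, represents xi z.
Proof.
have [[x xZ] <-] : exists x, homology_class (as_cobd_to X G q) x = z.
  by exists (repr z); exact: reprK.
have [xi xiE] : exists xi, germ xi = x by exists (repr x); exact: reprK.
subst x.
have h : cobd xi \in @locally_zero X G q.+1.
  rewrite -[cobd xi]subr0; apply/germ_eq; rewrite -as_cobdE raddf0.
  exact/eqP.
exists xi, h; congr homology_class; exact: val_inj.
Qed.

(** Coherence of [gamma] lets a finer representative compute [xi(c)]. *)
Lemma evaluate_finer_representative q (gamma : cech_homology X G q)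
    (U W : open_cover X) (xi : cochain X G q)
    (c : small_cycle G U q) (d : small_cycle G W q) :
  refines W U -> zero_over U (cobd xi) ->
  small_representative gamma c -> small_representative gamma d ->
  evaluate xi (cycle_chain c) = evaluate xi (cycle_chain d).
Proof.
move=> WU xiU cg dg.
have := component_coherent gamma WU; rewrite -dg refinement_mapE -cg => cd.
exact: evaluate_homologous xiU (esym cd).
Qed.

End Evaluation.

Theorem theorem14 (X : topologicalType) (G : pzRingType) (q : nat)
    (z : alexander_spanier X G q) (gamma : cech_homology X G q) :
  (exists (xi : cochain X G q) (U : open_cover X) (c : small_cycle G U q),
     [/\ represents xi z, zero_over U (cobd xi)
       & small_representative gamma c]) /\
  (forall (xi xi' : cochain X G q) (U U' : open_cover X)
     (c : small_cycle G U q) (c' : small_cycle G U' q),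
     represents xi z -> zero_over U (cobd xi) -> small_representative gamma c ->
     represents xi' z -> zero_over U' (cobd xi') ->
     small_representative gamma c' ->
     evaluate xi (cycle_chain c) = evaluate xi' (cycle_chain c')).
Proof.
split.
  have [xi xiz] := exists_represents z.
  have [/asboolP[U xiU] _] := xiz.
  have [c cg] := exists_small_representative gamma U.
  by exists xi, U, c.
move=> xi xi' U U' c c' xiz xiU cg xiz' xiU' cg'.
have [V xiV] := represents_eq_evaluate xiz xiz'.
pose W := common_refinement (common_refinement U U') V.
have WUU' : refines W (common_refinement U U') by exact: common_refinementl.
have [d dg] := exists_small_representative gamma W.
rewrite (evaluate_finer_representative _ xiU cg dg); last first.
  exact: refines_trans WUU' (@common_refinementl _ _ _).
rewrite (evaluate_finer_representative _ xiU' cg' dg); last first.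
  exact: refines_trans WUU' (@common_refinementr _ _ _).
exact: xiV (@common_refinementr _ _ _) d.
Qed.
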